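(* Let $m,n\in\mathbb{Z}$ with $\gcd(m,n)=1$ and $mn(m+n)\neq 0$, and put $c=-\frac{A(m,n)}{B(m,n)}$. (a) The fraction $\frac{A(m,n)}{B(m,n)}$ is in lowest terms; in particular the exact denominator of $c$ is $B(m,n)=16\,C(m,n)^2$, where $C(m,n)=\frac{mn(m+n)}{2}\in\mathbb{Z}$. (b) $c=-\dfrac{\mathrm{N}_{\mathbb{Q}(\zeta)/\mathbb{Q}}\big(m-(\zeta+\zeta^2)n\big)}{(4C(m,n))^2}$, where $\zeta=e^{2\pi i/7}$. (c) $c=-\tfrac{29}{16}$ is the only rational number whose denominator is a power of $2$ for which $f_c$ has a rational $3$-cycle. (d) If $c$ is the only rational number with its denominator for which $f_c$ has a rational $3$-cycle, then $c=-\tfrac{29}{16}$. (e) If $A(m,n)=q^e$ is a power of a prime $q\neq 7$, then $c$ is the only rational number with numerator $-q^e$ (i.e. $c=-q^e/D$ in lowest terms for some $D$) for which $f_c$ has a rational $3$-cycle. The same conclusion holds if $A(m,n)=7q^e$ for some prime power $q^e$.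
   Context: For $c\in\mathbb{Q}$ let $f_c(x)=x^2+c$; a rational $3$-cycle is the orbit of a rational point of minimal period $3$. Define $A(m,n)=m^6+2m^5n+4m^4n^2+8m^3n^3+9m^2n^4+4mn^5+n^6$, $B(m,n)=4m^2n^2(m+n)^2$. Standing fact (from the rational parametrization of period-3 points): $f_c$ has a rational $3$-cycle if and only if $c=-A(m,n)/B(m,n)$ for some $m,n\in\mathbb{Z}$ with $\gcd(m,n)=1$ and $mn(m+n)\neq0$; and $f_c$ has at most one rational $3$-cycle. *)

(* Defs.v *)
From HB Require Import structures.
From mathcomp Require Import all_boot all_order all_algebra all_field.
Set Implicit Arguments. Unset Strict Implicit. Unset Printing Implicit Defensive.
Import Order.TTheory GRing.Theory Num.Theory.
Local Open Scope ring_scope.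

Definition polyAmn (m n : int) : int :=
  m ^+ 6 + 2 * m ^+ 5 * n + 4 * m ^+ 4 * n ^+ 2 + 8 * m ^+ 3 * n ^+ 3
  + 9 * m ^+ 2 * n ^+ 4 + 4 * m * n ^+ 5 + n ^+ 6.
Definition polyBmn (m n : int) : int := 4 * m ^+ 2 * n ^+ 2 * (m + n) ^+ 2.

Definition polyCmn (m n : int) : int := ((m * n * (m + n)) %/ 2)%Z.

Definition cpar (m n : int) : rat := - ((polyAmn m n)%:~R / (polyBmn m n)%:~R).

Definition fc (c : rat) (x : rat) : rat := x ^+ 2 + c.

Definition minimal_period3 (c x : rat) : Prop :=
  iter 3 (fc c) x = x /\ (forall k : nat, (0 < k < 3)%N -> iter k (fc c) x <> x).

Definition has_rat_3cycle (c : rat) : Prop := exists x : rat, minimal_period3 c x.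

(* zeta = e^{2 pi i/7} in the algebraic complex numbers: 7.-root (-1) is
   e^{i pi/7} (the 7th root of -1 of minimal nonnegative argument). *)
Definition zeta7 : algC := (7.-root (-1)) ^+ 2.

(* Norm from Q(zeta) to Q of alpha = m - (zeta + zeta^2) n: product of its
   images under the 6 embeddings zeta |-> zeta^k, k = 1..6. *)
Definition norm_Qzeta7 (m n : int) : algC :=
  \prod_(1 <= k < 7) (m%:~R - (zeta7 ^+ k + zeta7 ^+ (2 * k)) * n%:~R).

(* Main.v *)
(** The sums of consecutive points of a 3-cycle have product 1, so the cycle is
    determined by [t = x + f_c(x)]; with [t = m / n] this gives [c = - A / B].
    Exchanging [m] and [n] preserves [B], and [A(m, n) - A(n, m)] splits into
    the linear forms [m], [n], [m + n], [m - n], [2 m + n], [m + 2 n], whence (d).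

    For (e), put [beta = m - (zeta + zeta^2) n], of norm [N = A(m, n)].  Modulo
    [beta], [zeta] is congruent to a rational integer [w] with [N | Phi_7(w)].  If
    [A(m', n') = N] too, then [N] divides the product over [k = 1..6] of
    [m' - (w^k + w^(2 k)) n'].  A prime other than 2 and 7 divides at most one
    factor, so [N] divides one of them, i.e. [beta] divides the conjugate
    [alpha = m' - (zeta^k + zeta^(2 k)) n'].  Having the same norm, they differ by a
    unit [eps] of [Z[zeta]], and [eps / conj eps] is [+- zeta^j].  For each [k], [j]
    and sign this is a linear system in [m m'], [m n'], [n m'], [n n'], whose
    nondegenerate solutions are the three parameters [m' / n'] of the same cycle. *)
Require Import Defs.
From HB Require Import structures.
From mathcomp Require Import all_boot all_order all_algebra all_field.
From mathcomp Require Import ring lra zify.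
Import Order.TTheory GRing.Theory Num.Theory.
Set Implicit Arguments.
Unset Strict Implicit.
Local Open Scope ring_scope.

(** * Rational 3-cycles and the parameter [t] *)

(* [cpar] in terms of [t = m / n]; the cycle is recovered from [t = x + f_c(x)]. *)
Definition cdyn (t : rat) : rat :=
  - ((t ^+ 6 + 2 * t ^+ 5 + 4 * t ^+ 4 + 8 * t ^+ 3 + 9 * t ^+ 2 + 4 * t + 1)
     / (4 * t ^+ 2 * (t + 1) ^+ 2)).

Lemma cpar_cdyn (m n : int) : m * n * (m + n) != 0 ->
  cpar m n = cdyn (m%:~R / n%:~R).
Proof.
rewrite !mulf_eq0 !negb_or => /andP[/andP[m0 n0] mn0].
have m0r : m%:~R != 0 :> rat by rewrite intr_eq0.
have n0r : n%:~R != 0 :> rat by rewrite intr_eq0.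
have mn0r : m%:~R + n%:~R != 0 :> rat by rewrite -intrD intr_eq0.
rewrite /cpar /cdyn /polyAmn /polyBmn !(intrD, intrM, rmorphXn) /=; field.
by rewrite m0r n0r mn0r.
Qed.

Lemma cdyn_cycle (t : rat) : t != 0 -> t + 1 != 0 -> has_rat_3cycle (cdyn t).
Proof.
move=> t0 t1.
pose d := 2 * t * (t + 1).
pose x := (t ^+ 3 + 2 * t ^+ 2 + t + 1) / d.
pose y := (t ^+ 3 - t - 1) / d.
pose z := - (t ^+ 3 + 2 * t ^+ 2 + 3 * t + 1) / d.
have xy : fc (cdyn t) x = y by rewrite /fc /cdyn /x /y /d; field; rewrite t0 t1.
have yz : fc (cdyn t) y = z by rewrite /fc /cdyn /z /y /d; field; rewrite t0 t1.
have zx : fc (cdyn t) z = x by rewrite /fc /cdyn /x /z /d; field; rewrite t0 t1.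
(* The differences [x - y] and [x - z] both have this factor in the numerator, and four times it is
   [(2 * t + 1) ^+ 2 + 3]. Hence neither [f_c] nor its second iterate fixes [x]. *)
have q0 : t ^+ 2 + t + 1 != 0.
  by apply: lt0r_neq0; have := sqr_ge0 (2 * t + 1); lra.
exists x; split=> [|[|[|[|k]]] // _] /=; rewrite ?xy ?yz ?zx // => e.
- have : x - y = (t ^+ 2 + t + 1) / (t * (t + 1)).
    by rewrite /x /y /d; field; rewrite t0 t1.
  by rewrite e subrr => /esym/eqP; rewrite !mulf_eq0 invr_eq0 mulf_eq0
    (negPf q0) (negPf t0) (negPf t1).
- have : x - z = (t ^+ 2 + t + 1) / t.
    by rewrite /x /z /d; field; rewrite t0 t1.
  by rewrite e subrr => /esym/eqP; rewrite mulf_eq0 invr_eq0 (negPf q0) (negPf t0).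
Qed.

(** Since [f_c(u) - f_c(v) = (u - v) * (u + v)], each difference of consecutive points is the
    preceding difference times a sum of two points. The three differences add up to 0, which gives
    [z + x = - 1 / (t + 1)] for [t = x + y]; this determines [x], and then [c], in terms of [t]. *)
Lemma cycle_cdyn (c : rat) : has_rat_3cycle c ->
  exists t : rat, [/\ t != 0, t + 1 != 0 & c = cdyn t].
Proof.
case=> x [/= zx nfix].
have := nfix 1%N isT; have := nfix 2%N isT => /=.
set y := fc c x in zx *; set z := fc c y in zx * => /eqP zx0 /eqP yx0.
have yE : y = x ^+ 2 + c by [].
have zE : z = y ^+ 2 + c by [].
have xE : x = z ^+ 2 + c by rewrite -[LHS]zx.
clearbody z y.
have eyz : y - z = (x - y) * (x + y) by rewrite zE {1}yE; ring.
have ezx : z - x = (y - z) * (y + z) by rewrite {1}xE {1}zE; ring.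
have exy : x - y = (z - x) * (z + x) by rewrite {1}yE {1}xE; ring.
(* If [x + y = 0], all three differences vanish; if [x + y = -1], then [z = x]. *)
have t0 : x + y != 0.
  apply: contra yx0 => /eqP t0.
  by rewrite eq_sym -subr_eq0 exy ezx eyz t0 !(mulr0, mul0r).
have t1 : x + y + 1 != 0.
  apply: contra zx0 => /eqP t1; apply/eqP.
  have e : x + y = -1 by lra. rewrite e in eyz; lra.
have ezx' : z - x = - (x + y + 1) * (x - y) by rewrite mulrC; lra.
have s1 : - (x + y + 1) * (z + x) = 1.
  apply: (@mulfI _ (x - y)); first by rewrite subr_eq0 eq_sym.
  by rewrite mulr1 [RHS]exy ezx'; ring.
have zE2 : z = y - (x - y) * (x + y) by lra.
exists (x + y); split=> //.
have xt : 2 * (x + y) * x = x + y + (x + y) ^+ 2 + 1 / (x + y + 1).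
  have -> : 1 / (x + y + 1) = - (z + x) by apply: (mulfI t1);
    rewrite mul1r mulfV // mulrN -mulNr s1.
  by rewrite zE2; ring.
set t := x + y in t0 t1 xt *.
have {}xt : x = (t ^+ 3 + 2 * t ^+ 2 + t + 1) / (2 * t * (t + 1)).
  apply: (@mulfI _ (2 * t)); first by rewrite mulf_neq0.
  by rewrite xt; field; rewrite t0 t1.
have -> : c = t - x - x ^+ 2 by rewrite /t yE; ring.
by rewrite xt /cdyn; field; rewrite t0 t1.
Qed.

Lemma cpar_cycle (m n : int) : m * n * (m + n) != 0 -> has_rat_3cycle (cpar m n).
Proof.
move=> h; rewrite cpar_cdyn //; move: h.
rewrite !mulf_eq0 !negb_or => /andP[/andP[m0 n0] mn0].
have n0r : n%:~R != 0 :> rat by rewrite intr_eq0.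
apply: cdyn_cycle; first by rewrite mulf_neq0 ?invr_eq0 ?intr_eq0.
have -> : m%:~R / n%:~R + 1 = (m + n)%:~R / n%:~R :> rat by rewrite intrD; field.
by rewrite mulf_neq0 ?invr_eq0 ?intr_eq0.
Qed.

Lemma cycle_cpar (c : rat) : has_rat_3cycle c ->
  exists m n : int, [/\ coprimez m n, m * n * (m + n) != 0 & c = cpar m n].
Proof.
move=> /cycle_cdyn[t [t0 t1 ->]]; exists (numq t), (denq t).
have h : numq t * denq t * (numq t + denq t) != 0.
  rewrite !mulf_neq0 ?denq_neq0 ?numq_eq0 //.
  apply: contra t1 => /eqP e; rewrite -[t]divq_num_den.
  have -> : numq t = - denq t by lia.
  by rewrite mulrNz mulNr divff ?intr_eq0 ?denq_neq0 // addNr.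
by split=> //; [rewrite /coprimez; exact: coprime_num_den | rewrite cpar_cdyn // divq_num_den].
Qed.

(** * Numerator and denominator of [c], and the value -29/16 *)

Lemma cpar11 : cpar 1 1 = - 29 / 16.
Proof. by apply/eqP; vm_compute. Qed.

Lemma int_parity (m : int) : exists a : int, m = 2 * a \/ m = 2 * a + 1.
Proof. by exists (m %/ 2)%Z; lia. Qed.

Lemma even_prod_sum (m n : int) : (2 %| m * n * (m + n))%Z.
Proof.
have [a [->|->]] := int_parity m.
  by apply/dvdzP; exists (a * n * (2 * a + n)); ring.
have [b [->|->]] := int_parity n; apply/dvdzP.
  by exists ((2 * a + 1) * b * (2 * a + 1 + 2 * b)); ring.
by exists ((2 * a + 1) * (2 * b + 1) * (a + b + 1)); ring.
Qed.

(** The form reduces to [n ^+ 6] modulo [m] and modulo [m + n], and to [m ^+ 6] modulo [n]. *)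
Lemma coprime_polyA (m n : int) : coprimez m n -> coprimez (polyAmn m n) (m * n * (m + n)).
Proof.
move=> cmn.
have cm : coprimez (polyAmn m n) m.
  have -> : polyAmn m n = (m ^+ 5 + 2 * m ^+ 4 * n + 4 * m ^+ 3 * n ^+ 2
      + 8 * m ^+ 2 * n ^+ 3 + 9 * m * n ^+ 4 + 4 * n ^+ 5) * m + n ^+ 6.
    by rewrite /polyAmn; ring.
  rewrite /coprimez gcdzC gcdzMDl.
  by rewrite -/(coprimez _ _) coprimezXr.
have cn : coprimez (polyAmn m n) n.
  have -> : polyAmn m n = (2 * m ^+ 5 + 4 * m ^+ 4 * n + 8 * m ^+ 3 * n ^+ 2
      + 9 * m ^+ 2 * n ^+ 3 + 4 * m * n ^+ 4 + n ^+ 5) * n + m ^+ 6.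
    by rewrite /polyAmn; ring.
  rewrite /coprimez gcdzC gcdzMDl -/(coprimez _ _) coprimezXr //.
  by rewrite coprimez_sym.
have cs : coprimez (polyAmn m n) (m + n).
  have -> : polyAmn m n = (m ^+ 4 * (m + n) + 3 * m ^+ 3 * n ^+ 2 + 5 * m ^+ 2 * n ^+ 3
     + 4 * m * n ^+ 4 ) * (m + n) + n ^+ 6.
    by rewrite /polyAmn; ring.
  rewrite /coprimez gcdzC gcdzMDl -/(coprimez _ _) coprimezXr // /coprimez.
  by rewrite gcdzC addrC gcdzDl gcdzC.
by rewrite !coprimezMr cm cn cs.
Qed.

Lemma odd_polyA (m n : int) : coprimez m n -> coprimez (polyAmn m n) 2.
Proof.
move=> /coprime_polyA; apply: coprimez_dvdr; exact: even_prod_sum.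
Qed.

Lemma polyB_sqr (m n : int) : polyBmn m n = (2 * (m * n * (m + n))) ^+ 2.
Proof. by rewrite /polyBmn; ring. Qed.

Lemma coprime_polyA_polyB (m n : int) : coprimez m n -> coprimez (polyAmn m n) (polyBmn m n).
Proof.
by move=> h; rewrite polyB_sqr coprimezXr // coprimezMr odd_polyA // coprime_polyA.
Qed.

Lemma polyB_gt0 (m n : int) : m * n * (m + n) != 0 -> 0 < polyBmn m n.
Proof. by move=> h; rewrite polyB_sqr lt0r sqr_ge0 sqrf_eq0 mulf_neq0. Qed.

Lemma polyC_sqr (m n : int) : polyBmn m n = 16 * polyCmn m n ^+ 2.
Proof.
have := divzK (even_prod_sum m n); rewrite -/(polyCmn m n) => e.
by rewrite polyB_sqr -e; ring.
Qed.

Lemma cpar_num_den (m n : int) : coprimez m n -> m * n * (m + n) != 0 ->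
  numq (cpar m n) = - polyAmn m n /\ denq (cpar m n) = polyBmn m n.
Proof.
move=> cmn /polyB_gt0 b0; have cAB := coprime_polyA_polyB cmn.
have cAB' : coprime `|- polyAmn m n| `|polyBmn m n| by rewrite abszN.
rewrite /cpar -mulNr -rmorphN /= coprimeq_num // coprimeq_den //.
by rewrite gtr0_sg // mul1r gt_eqF // gtr0_norm.
Qed.

Lemma polyA_swap (m n : int) : polyAmn m n - polyAmn n m =
  - (m * n * (m + n)) * ((m - n) * ((2 * m + n) * (m + 2 * n))).
Proof. by rewrite /polyAmn; ring. Qed.

(** The three linear factors correspond to [m / n = 1], [-1/2] and [-2], the three parameters of the
    cycle for [c = -29/16]. *)
Lemma cpar_special (m n : int) : m * n * (m + n) != 0 ->
  (m - n) * ((2 * m + n) * (m + 2 * n)) = 0 -> cpar m n = - 29 / 16.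
Proof.
move=> h /eqP; rewrite !mulf_eq0; move: h; rewrite /cpar.
have gen k (P Q : int) : k != 0 -> P = 29 * k ^+ 6 -> Q = 16 * k ^+ 6 ->
    - (P%:~R / Q%:~R) = - 29 / 16 :> rat.
  move=> k0 -> ->; rewrite !(intrM, rmorphXn) /=; field.
  by rewrite intr_eq0.
rewrite /polyAmn /polyBmn !mulf_eq0 !negb_or -!andbA => /and3P[m0 n0 s0].
case/orP=> [|/orP[]] /eqP d.
- by apply: (gen m) => //; (have -> : n = m by lia); ring.
- by apply: (gen m) => //; (have -> : n = - (2 * m) by lia); ring.
- by apply: (gen n) => //; (have -> : m = - (2 * n) by lia); ring.
Qed.

(** * Seventh roots of unity and integer relations between the powers of [zeta7] *)

Lemma zeta7_prim : 7.-primitive_root zeta7.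
Proof.
have e : (7.-root (-1) : algC) ^+ 7 = -1 by exact: rootCK.
have z7 : zeta7 ^+ 7 = 1 by rewrite /zeta7 exprAC e expr2 mulrNN mulr1.
(* Otherwise the chosen root of -1 has square 1 and seventh power -1, so it is -1 itself; but
   [7.-root] never takes a negative value. *)
have z1 : zeta7 != 1.
  apply/negP => /eqP z1; move: e; rewrite (exprD _ 6 1) (exprM _ 2 3) -/zeta7 z1 expr1n mul1r.
  by move=> e; have := rootC_lt0 (-1 : algC) (isT : (1 < 7)%N); rewrite -[X in X < 0]expr1 e ltrN10.
have [[|[|k]] // p7 d] := prim_order_exists (isT : (0 < 7)%N) z7.
  by rewrite (eqP (_ : zeta7 == 1)) // ?eqxx // in z1; apply/eqP;
    rewrite -[zeta7]expr1 prim_expr_order.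
by have /primeP[_ /(_ _ d)] : prime 7 by []; rewrite /= => /eqP <-.
Qed.

Lemma prim7_sum (F : idomainType) (y : F) : 7.-primitive_root y -> \sum_(i < 7) y ^+ i = 0.
Proof.
move=> p; have y1 : y - 1 != 0.
  by rewrite subr_eq0; have := prim_root_eq0 p; have := eq_prim_root_expr p 1 0;
    rewrite expr1 expr0 => ->.
apply: (mulfI y1); rewrite mulr0.
by rewrite -subrX1 prim_expr_order // subrr.
Qed.

Lemma zeta7_pow_prim (k : nat) : (0 < k < 7)%N -> 7.-primitive_root (zeta7 ^+ k).
Proof.
move=> hk; rewrite prim_root_exp_coprime ?zeta7_prim //.
by move: k hk => [|[|[|[|[|[|[|]]]]]]].
Qed.

(** Subtracting [a 6] times the sum of all seven powers leaves a polynomial of degree at most 5 that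
    vanishes at [zeta7], whose minimal polynomial has degree 6. *)
Lemma zeta7_free (a : nat -> int) : \sum_(i < 7) (a i)%:~R * zeta7 ^+ i = 0 ->
  forall i, (i < 7)%N -> a i = a 6%N.
Proof.
move=> h.
pose p : {poly rat} := \poly_(i < 6) (a i - a 6%N)%:~R.
have rp : root (map_poly ratr p) zeta7.
  rewrite /root (horner_coef_wide _ (_ : _ <= 6)%N); last first.
    by rewrite size_map_poly size_poly.
  apply/eqP; transitivity (\sum_(i < 7) (a i)%:~R * zeta7 ^+ i
      - (a 6%N)%:~R * \sum_(i < 7) zeta7 ^+ i).
    rewrite mulr_sumr -sumrB [RHS]big_ord_recr /= subrr addr0; apply: eq_bigr => i _.
    by rewrite coef_map coef_poly ltn_ord /= ratr_int intrB mulrBl.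
  by rewrite h prim7_sum ?zeta7_prim // mulr0 subrr.
have [q [qE _] qP] := minCpolyP zeta7.
have p0 : p = 0.
  apply/eqP; rewrite qP in rp; apply: contraLR rp => p0; apply/negP => /(dvdp_leq p0).
  rewrite -(size_map_poly (ratr : rat -> algC)) -qE (minCpoly_cyclotomic zeta7_prim).
  by rewrite size_cyclotomic leqNgt (leq_ltn_trans (size_poly _ _)).
move=> i; rewrite ltnS leq_eqVlt => /orP[/eqP -> //| i6].
have := congr1 (fun p : {poly rat} => p`_i) p0.
by rewrite coef_poly i6 coef0 => /eqP; rewrite intr_eq0 subr_eq0 => /eqP.
Qed.

(** Lists of pairs (coefficient, exponent) stand for formal sums of powers, so that a relation can
    be written down before its exponents are reduced modulo 7. *)
Definition zcoef (e : seq (int * nat)) (r : nat) : int :=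
  \sum_(t <- e | (t.2 %% 7)%N == r) t.1.

Lemma zcoef_sum (e : seq (int * nat)) (y : algC) : y ^+ 7 = 1 ->
  \sum_(t <- e) t.1%:~R * y ^+ t.2 = \sum_(i < 7) (zcoef e i)%:~R * y ^+ i.
Proof.
move=> y7; under [RHS]eq_bigr => i _ do rewrite /zcoef rmorph_sum mulr_suml.
rewrite (exchange_big_dep xpredT) //=; apply: eq_bigr => t _.
rewrite (big_pred1 (Ordinal (ltn_pmod t.2 (isT : (0 < 7)%N)))) /=.
  by rewrite expr_mod.
by move=> i /=; rewrite eq_sym.
Qed.

Lemma zcoef_eq (e : seq (int * nat)) : \sum_(t <- e) t.1%:~R * zeta7 ^+ t.2 = 0 ->
  forall r, (r < 7)%N -> zcoef e r = zcoef e 6.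
Proof. by rewrite zcoef_sum ?(prim_expr_order zeta7_prim) // => /zeta7_free. Qed.

(** * The ring [Z[zeta]] through integer polynomials *)

(** A polynomial represents an element of [Z[zeta]]. Evaluating it at the other primitive roots
    replaces the Galois action, and evaluating it at an integer [w] gives the reductions modulo
    divisors of [Phi_7(w)]. *)
Definition evz (p : {poly int}) (y : algC) : algC := (map_poly intr p).[y].

Lemma evzD p q y : evz (p + q) y = evz p y + evz q y.
Proof. by rewrite /evz rmorphD hornerD. Qed.
Lemma evzN p y : evz (- p) y = - evz p y.
Proof. by rewrite /evz rmorphN hornerN. Qed.
Lemma evzM p q y : evz (p * q) y = evz p y * evz q y.
Proof. by rewrite /evz rmorphM hornerM. Qed.
Lemma evzX y : evz 'X y = y.
Proof. by rewrite /evz map_polyX hornerX. Qed.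
Lemma evzC a y : evz a%:P y = a%:~R.
Proof. by rewrite /evz map_polyC hornerC. Qed.
Lemma evz_comp p q y : evz (p \Po q) y = evz p (evz q y).
Proof. by rewrite /evz map_comp_poly horner_comp. Qed.
Lemma evzXn p k y : evz (p ^+ k) y = evz p y ^+ k.
Proof. by rewrite /evz rmorphXn horner_exp. Qed.

Definition phi7 : {poly int} := \poly_(i < 7) 1.

Lemma evz_phi7 y : evz phi7 y = \sum_(i < 7) y ^+ i.
Proof.
rewrite /evz (horner_coef_wide _ (_ : _ <= 7)%N); last first.
  by rewrite (leq_trans (size_poly _ _)) ?size_poly.
by apply: eq_bigr => i _; rewrite coef_map coef_poly ltn_ord mul1r.
Qed.

Lemma divp_phi7 (p : {poly int}) : exists (q : {poly int}) (a : nat -> int),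
  p = q * phi7 + \poly_(i < 7) a i.
Proof.
have sz : size phi7 = 7%N by rewrite size_poly_eq.
have mon : phi7 \is monic by rewrite monicE /lead_coef sz coef_poly.
(* The remainder has degree at most 5; its zero coefficient of index 6 is kept to match the
   seven-term sums of [zeta7_free]. *)
exists (Pdiv.CommonRing.rdivp p phi7), (fun i => (Pdiv.CommonRing.rmodp p phi7)`_i).
rewrite {1}(Pdiv.RingMonic.rdivp_eq mon p); congr (_ + _).
apply/polyP => i; rewrite coef_poly.
case: ltnP => // i7; rewrite nth_default // (leq_trans _ i7) // ltnW //.
by rewrite -sz Pdiv.CommonRing.ltn_rmodpN0 ?monic_neq0.
Qed.

Lemma evz_poly7 (a : nat -> int) y :
  evz (\poly_(i < 7) a i) y = \sum_(i < 7) (a i)%:~R * y ^+ i.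
Proof.
rewrite /evz (horner_coef_wide _ (_ : _ <= 7)%N); last first.
  by rewrite (leq_trans (size_poly _ _)) ?size_poly.
by apply: eq_bigr => i _; rewrite coef_map coef_poly ltn_ord.
Qed.

Lemma evz_coef (p : {poly int}) : exists a : nat -> int,
  forall y, 7.-primitive_root y -> evz p y = \sum_(i < 7) (a i)%:~R * y ^+ i.
Proof.
have [q [a ->]] := divp_phi7 p; exists a => y /prim7_sum y7.
by rewrite evzD evzM evz_phi7 y7 mulr0 add0r evz_poly7.
Qed.

Lemma evz_eq0 (p : {poly int}) : evz p zeta7 = 0 -> exists q, p = q * phi7.
Proof.
have [q [a ->]] := divp_phi7 p.
rewrite evzD evzM evz_phi7 (prim7_sum zeta7_prim) mulr0 add0r evz_poly7 => /zeta7_free h.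
exists (q + (a 6%N)%:P); rewrite mulrDl; congr (_ + _); apply/polyP => i.
by rewrite coefCM !coef_poly; case: ltnP => [/h ->|]; rewrite (mulr1, mulr0).
Qed.

(** Galois invariance of relations: [phi7] divides [p] and vanishes at every primitive seventh root
    of unity. *)
Lemma evz_conj (p : {poly int}) (y : algC) : 7.-primitive_root y ->
  evz p zeta7 = 0 -> evz p y = 0.
Proof. by move=> /prim7_sum y7 /evz_eq0[q ->]; rewrite evzM evz_phi7 y7 mulr0. Qed.

(** This makes the ring morphism from [Z[zeta]] to [Z/N] sending [zeta7] to [w] well defined. *)
Lemma evz_eq0_modz (p : {poly int}) (N w : int) : (N %| \sum_(i < 7) w ^+ i)%Z ->
  evz p zeta7 = 0 -> (N %| p.[w])%Z.
Proof.
move=> d /evz_eq0[q ->]; rewrite hornerM dvdz_mull //.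
rewrite /phi7 horner_poly; congr (_ %| _)%Z: d.
by apply: eq_bigr => i _; rewrite mul1r.
Qed.

(** * The norm form, and reduction of [zeta7] to a rational integer *)

(** The six factors are grouped by the squares 1, 2, 4 and the nonsquares 3, 5, 6 modulo 7. Each
    partial product is a cubic form over the quadratic subfield, generated by the Gaussian period
    [h] with [h ^+ 2 + h + 2 = 0]. *)
Lemma norm_prim7 (y : algC) (m n : int) : 7.-primitive_root y ->
  \prod_(1 <= k < 7) (m%:~R - (y ^+ k + y ^+ (2 * k)) * n%:~R) = (polyAmn m n)%:~R.
Proof.
move=> py; have y7 := prim_expr_order py; have := prim7_sum py.
have e k l : (k %% 7 = l %% 7)%N -> y ^+ k = y ^+ l.
  by move=> h; rewrite -(expr_mod k y7) -(expr_mod l y7) h.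
rewrite !big_ord_recr big_ord0 /= add0r expr0 expr1 => s0.
rewrite unlock /= !muln1 !expr1 mulr1.
rewrite (e 8%N 1%N) // (e 10%N 3%N) // (e 12%N 5%N) //.
rewrite /polyAmn !(intrD, intrM, rmorphXn) /=.
set M := m%:~R; set K := n%:~R.
pose h := y + y ^+ 2 + y ^+ 4; pose h' := y ^+ 3 + y ^+ 5 + y ^+ 6.
have h'E : h' = - 1 - h by apply/eqP; rewrite -subr_eq0 -s0; apply/eqP; rewrite /h /h'; ring.
have hh : h ^+ 2 + h + 2 = 0.
  transitivity (2 * (1 + y + y ^+ 2 + y ^+ 3 + y ^+ 4 + y ^+ 5 + y ^+ 6) + (y ^+ 7 - 1) * y).
    by rewrite /h; ring.
  by rewrite s0 y7 subrr mulr0 mul0r addr0.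
pose b := 2 * M ^+ 2 * K + 2 * M * K ^+ 2.
have c1 : (M - (y + y ^+ 2) * K) * (M - (y ^+ 2 + y ^+ 4) * K) * (M - (y ^+ 4 + y) * K)
    = M ^+ 3 - 3 * M * K ^+ 2 - K ^+ 3 - h * b.
  transitivity (M ^+ 3 - 2 * h * M ^+ 2 * K + (h ^+ 2 + h') * M * K ^+ 2
      - (h * h' - y ^+ 7) * K ^+ 3); first by rewrite /h /h'; ring.
  rewrite y7 h'E; apply/eqP; rewrite -subr_eq0; apply/eqP.
  transitivity ((h ^+ 2 + h + 2) * (M * K ^+ 2 + K ^+ 3)); first by rewrite /b; ring.
  by rewrite hh mul0r.
have c2 : (M - (y ^+ 3 + y ^+ 6) * K) * (M - (y ^+ 5 + y ^+ 3) * K) * (M - (y ^+ 6 + y ^+ 5) * K)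
    = M ^+ 3 + 2 * M ^+ 2 * K - M * K ^+ 2 - K ^+ 3 + h * b.
  transitivity (M ^+ 3 - 2 * h' * M ^+ 2 * K + (h' ^+ 2 + y ^+ 7 * h) * M * K ^+ 2
      - (h' * (y ^+ 7 * h) - y ^+ 7 * y ^+ 7) * K ^+ 3); first by rewrite /h /h'; ring.
  rewrite y7 h'E; apply/eqP; rewrite -subr_eq0; apply/eqP.
  transitivity ((h ^+ 2 + h + 2) * (M * K ^+ 2 + K ^+ 3)); first by rewrite /b; ring.
  by rewrite hh mul0r.
match goal with |- ?l = _ => transitivity
  (((M - (y + y ^+ 2) * K) * (M - (y ^+ 2 + y ^+ 4) * K) * (M - (y ^+ 4 + y) * K)) *
   ((M - (y ^+ 3 + y ^+ 6) * K) * (M - (y ^+ 5 + y ^+ 3) * K) * (M - (y ^+ 6 + y ^+ 5) * K))) end.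
  by ring.
rewrite c1 c2; apply/eqP; rewrite -subr_eq0; apply/eqP.
transitivity (- (h ^+ 2 + h + 2) * b ^+ 2); first by rewrite /b; ring.
by rewrite hh oppr0 mul0r.
Qed.

Definition thpoly (m n : int) (k : nat) : {poly int} :=
  m%:P - ('X^k + 'X^(2 * k)) * n%:P.

Lemma evz_thpoly m n k y :
  evz (thpoly m n k) y = m%:~R - (y ^+ k + y ^+ (2 * k)) * n%:~R.
Proof. by rewrite /thpoly evzD evzN evzM evzD !evzXn !evzX !evzC. Qed.

Lemma horner_thpoly m n k w : (thpoly m n k).[w] = m - (w ^+ k + w ^+ (2 * k)) * n.
Proof. by rewrite /thpoly !hornerE. Qed.

Lemma norm_modz (N w m n : int) : (N %| \sum_(i < 7) w ^+ i)%Z ->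
  (N %| \prod_(1 <= k < 7) (m - (w ^+ k + w ^+ (2 * k)) * n) - polyAmn m n)%Z.
Proof.
move=> d; pose p := \prod_(1 <= k < 7) thpoly m n k - (polyAmn m n)%:P.
have := @evz_eq0_modz p _ _ d; rewrite /p evzD evzN evzC.
rewrite /evz rmorph_prod horner_prod.
under eq_bigr => k _ do rewrite -/(evz _ _) evz_thpoly.
rewrite norm_prim7 ?zeta7_prim // subrr => /(_ erefl).
rewrite hornerD hornerN hornerC horner_prod.
by under eq_bigr => k _ do rewrite horner_thpoly.
Qed.

(* Modulo [m - (zeta + zeta^2) n] the root of unity becomes the rational integer
   [w] with [2 m n (m + n) w = m^3 + 2 m^2 n + m n^2 + n^3]: this fraction is the
   periodic point attached to [m / n]. *)
Lemma zeta7_modz (m n : int) : coprimez m n -> m * n * (m + n) != 0 ->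
  exists (w : int) (d : {poly int}),
    zeta7 - w%:~R = evz (thpoly m n 1) zeta7 * evz d zeta7 /\
    (polyAmn m n %| \sum_(i < 7) w ^+ i)%Z.
Proof.
move=> cmn h0; set N := polyAmn m n.
pose P := 2 * (m * n * (m + n)).
pose Q := m ^+ 3 + 2 * m ^+ 2 * n + m * n ^+ 2 + n ^+ 3.
have cPN : coprimez P N.
  by rewrite coprimez_sym coprimezMr odd_polyA // coprime_polyA.
have cNn : coprimez N n.
  by have := coprime_polyA cmn; rewrite !coprimezMr => /andP[/andP[]].
have [[a v] /= av] := coprimezP _ _ cPN.
(* Division of [K ^+ 3 * Phi_7(x)] by [M - (x + x ^+ 2) * K], with a remainder linear in [x]. At
   [zeta7] it shows that [beta] divides [P * zeta7 - Q]. *)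
have phi_id (R : comNzRingType) (M K x : R) :
    K ^+ 3 * (1 + x + x ^+ 2 + x ^+ 3 + x ^+ 4 + x ^+ 5 + x ^+ 6) =
    - (M - (x + x ^+ 2) * K) * (K ^+ 2 * x ^+ 4 + K * (M + K) * x ^+ 2 - M * K * x + (M + K) ^+ 2)
    - 2 * (M * K * (M + K)) * x + (M ^+ 3 + 2 * M ^+ 2 * K + M * K ^+ 2 + K ^+ 3) by ring.
pose bs := \prod_(2 <= k < 7) thpoly m n k.
have NE : evz (thpoly m n 1) zeta7 * evz bs zeta7 = N%:~R.
  rewrite /bs {2}/evz rmorph_prod horner_prod evz_thpoly.
  under eq_bigr => k _ do rewrite -/(evz _ _) evz_thpoly.
  by rewrite -(norm_prim7 _ _ zeta7_prim) [RHS]big_ltn.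
pose D := (n ^+ 2)%:P * 'X^4 + (n * (m + n))%:P * 'X^2 - (m * n)%:P * 'X + ((m + n) ^+ 2)%:P.
have Dz : P%:~R * zeta7 - Q%:~R = - (evz (thpoly m n 1) zeta7 * evz D zeta7).
  have := phi_id _ m%:~R n%:~R zeta7; have := prim7_sum zeta7_prim.
  rewrite !big_ord_recr big_ord0 /= add0r expr0 expr1 => ->.
  rewrite mulr0 evz_thpoly muln1 expr1 /D !(evzD, evzN, evzM, evzXn, evzX, evzC).
  rewrite /P /Q !(intrD, intrM, rmorphXn) /= => e.
  by apply/eqP; rewrite -subr_eq0 -oppr_eq0 e; apply/eqP; ring.
clearbody bs D.
(* From [a * P + v * N = 1], the difference [zeta7 - a * Q] equals
   [a * (P * zeta7 - Q) + v * N * zeta7], and both terms are multiples of [beta]. *)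
exists (a * Q), (bs * (v%:P * 'X) - D * a%:P); split.
  set be := evz (thpoly m n 1) zeta7 in NE Dz *.
  rewrite evzD evzN !evzM !evzC evzX [RHS]mulrBr !(mulrA be) NE -[_ * evz D _]opprK -Dz.
  have : a%:~R * P%:~R + v%:~R * N%:~R = 1 :> algC by rewrite -!intrM -intrD av.
  rewrite intrM => e; rewrite -[X in X - _](mul1r zeta7) -{1}e; ring.
have dPw : (N %| P * (a * Q) - Q)%Z.
  by apply/dvdzP; exists (- v * Q); rewrite -[X in _ - X]mul1r -av; ring.
set w := a * Q in dPw *.
(* After multiplication by [P ^+ 2], replacing [P * w] by [Q] leaves
   [P ^+ 2 * m - P * Q * n - Q ^+ 2 * n], which is exactly [- n * N]. *)
have dth : (N %| m - (w + w ^+ 2) * n)%Z.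
  rewrite -(Gauss_dvdzr _ (_ : coprimez N (P ^+ 2))); last first.
    by rewrite coprimez_sym coprimezXl.
  have -> : P ^+ 2 * (m - (w + w ^+ 2) * n) =
     - n * N - (P * w - Q) * (n * (P + (P * w + Q))).
    by rewrite /N /P /Q /polyAmn; ring.
  by apply: rpredB; [apply: dvdz_mull|apply: dvdz_mulr].
rewrite -(Gauss_dvdzr _ (_ : coprimez N (n ^+ 3))); last by rewrite coprimezXr.
rewrite !big_ord_recr big_ord0 /= add0r expr0 expr1 (phi_id _ m n w).
rewrite -addrA -/P -/Q (_ : - _ + _ = - (P * w - Q)); last by rewrite opprB addrC.
by apply: rpredB => //; rewrite mulNr rpredN; apply: dvdz_mulr.
Qed.

(** * Elements of [Z[zeta]] on the unit circle *)

Lemma zcoef_total (e : seq (int * nat)) : \sum_(r < 7) zcoef e r = \sum_(t <- e) t.1.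
Proof.
rewrite /zcoef (exchange_big_dep xpredT) //=; apply: eq_bigr => t _.
by rewrite (big_pred1 (Ordinal (ltn_pmod t.2 (isT : (0 < 7)%N)))).
Qed.

Lemma sum_sqr1 (I : finType) (b : I -> int) : \sum_i b i ^+ 2 = 1 ->
  exists (s : bool) (j : I), forall i, b i = (-1) ^+ s * (i == j)%:R.
Proof.
move=> h; have [j bj] : exists j, b j != 0.
  apply/existsP; apply: contraPT h => /existsPn h; rewrite big1 // => i _.
  by have /negPn/eqP -> := h i.
have gej : 1 <= b j ^+ 2 by rewrite -gtz0_ge1 lt0r sqr_ge0 sqrf_eq0 bj.
have rest : \sum_(i | i != j) b i ^+ 2 <= 0 by move: h; rewrite (bigD1 j) //= => h;
  rewrite -(lerD2l (b j ^+ 2)) h addr0.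
have r0 i : i != j -> b i = 0.
  move=> ij; apply/eqP; rewrite -sqrf_eq0 eq_le sqr_ge0 andbT.
  by apply: le_trans rest; rewrite (bigD1 i) //= lerDl sumr_ge0 // => k _; rewrite sqr_ge0.
have : b j ^+ 2 == 1.
  by rewrite -h (bigD1 j) //= big1 ?addr0 // => i /r0 ->.
rewrite sqrf_eq1 => /orP[] /eqP e; [exists false|exists true]; exists j => i;
  by case: eqVneq => [->|/r0 ->]; rewrite ?e ?mulr1 ?mulr0.
Qed.

(* The coefficients are determined up to a common shift, and [g conj(g) = 1] gives
   [7 sum a_i^2 - (sum a_i)^2 = 6]; hence [sum a_i = +-1 mod 7], and after a shift
   [sum a_i = +-1] and [sum a_i^2 = 1]. *)
Lemma unit_circle_zeta7 (g : {poly int}) : evz g zeta7 * evz g (zeta7 ^+ 6) = 1 ->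
  exists (s : bool) (j : nat), (j < 7)%N /\ evz g zeta7 = (-1) ^+ s * zeta7 ^+ j.
Proof.
have pz := zeta7_prim; have s0 := prim7_sum pz.
have [a aE] := evz_coef g.
rewrite !aE ?zeta7_pow_prim // => gg.
pose e := [seq (a i * a j, (i + 6 * j)%N) | i : 'I_7 <- enum 'I_7, j : 'I_7 <- enum 'I_7].
have eE (F : int * nat -> algC) : \sum_(t <- e) F t =
    \sum_(i < 7) \sum_(j < 7) F (a i * a j, (i + 6 * j)%N).
  by rewrite big_allpairs_dep big_enum; apply: eq_bigr => i _; rewrite big_enum.
(* Conjugation is [zeta7 ^+ 6], whence the exponents [i + 6 * j]. The extra term -1 makes the sum
   vanish, so its seven coefficients agree: the one at 0 is [S2 - 1], coming from [i = j], and their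
   total is [S ^+ 2 - 1]. *)
have /zcoef_eq h : \sum_(t <- (-1 : int, 0%N) :: e) t.1%:~R * zeta7 ^+ t.2 = 0.
  rewrite big_cons eE /= expr0 mulr1 rmorphN /= addrC; apply/eqP.
  rewrite subr_eq0; apply/eqP; rewrite -[RHS]gg mulr_suml; apply: eq_bigr => i _.
  rewrite mulr_sumr; apply: eq_bigr => j _.
  by rewrite /= rmorphM exprD exprM /=; ring.
pose S := \sum_(i < 7) a i; pose S2 := \sum_(i < 7) a i ^+ 2.
have c0 : zcoef ((-1 : int, 0%N) :: e) 0 = -1 + S2.
  rewrite /zcoef big_cons /=; congr (_ + _).
  rewrite big_mkcond big_allpairs_dep big_enum; apply: eq_bigr => i _ /=.
  rewrite big_enum -big_mkcond (big_pred1 i) // => j /=.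
  by rewrite -val_eqE /=; have := ltn_ord i; have := ltn_ord j; lia.
have tot : 7 * (S2 - 1) = S ^+ 2 - 1.
  transitivity (\sum_(r < 7) zcoef ((-1 : int, 0%N) :: e) r).
    under eq_bigr => r _ do rewrite h // -(h 0%N) // c0.
    by rewrite sumr_const card_ord -mulr_natl; ring.
  rewrite zcoef_total big_cons addrC; congr (_ + _).
  rewrite big_allpairs_dep big_enum expr2 mulr_suml; apply: eq_bigr => i _.
  by rewrite big_enum mulr_sumr.
have [c [u Su]] : exists c (u : int), u ^+ 2 = 1 /\ S = 7 * c + u.
  have [k [r [rk rE]]] : exists k (r : int), (0 <= r < 7) /\ S = 7 * k + r.
    by exists (S %/ 7)%Z, (S %% 7)%Z; lia.
  have S2E : S ^+ 2 = 7 * (S2 - 1) + 1 by rewrite tot subrK.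
  have [q rq] : exists q, r ^+ 2 = 7 * q + 1.
    exists (S2 - 1 - 7 * k ^+ 2 - 2 * k * r).
    by have -> : r ^+ 2 = S ^+ 2 - 7 * (7 * k ^+ 2 + 2 * k * r); [rewrite rE; ring|rewrite S2E;
      ring].
  have [r1|r6] : r = 1 \/ r = 6.
  - have : [|| r == 0, r == 1, r == 2, r == 3, r == 4, r == 5 | r == 6] by lia.
    by move: rq => /[swap] /or4P[|||/or4P[]] /eqP ->; lia.
  - by exists k, 1; rewrite rE r1.
  - by exists (k + 1), (-1); rewrite rE r6; split=> //; ring.
pose b (i : 'I_7) := a i - c.
have : \sum_i b i ^+ 2 = 1.
  have -> : \sum_i b i ^+ 2 = S2 - 2 * c * S + 7 * c ^+ 2.
    rewrite /S /S2 mulr_sumr -sumrB.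
    have -> : 7 * c ^+ 2 = \sum_(i < 7) c ^+ 2.
      by rewrite sumr_const card_ord; ring.
    by rewrite -big_split; apply: eq_bigr => i _; rewrite /b /=; ring.
  case: Su => u1 Su; move: tot; rewrite Su.
  have -> : (7 * c + u) ^+ 2 = 49 * c ^+ 2 + 14 * (c * u) + u ^+ 2 by ring.
  have -> : 2 * c * (7 * c + u) = 14 * c ^+ 2 + 2 * (c * u) by ring.
  by rewrite u1; lia.
move=> /sum_sqr1[s [j bE]]; exists s, j; split=> //.
transitivity (\sum_(i < 7) (b i)%:~R * zeta7 ^+ i).
  transitivity (\sum_(i < 7) (a i)%:~R * zeta7 ^+ i - c%:~R * \sum_(i < 7) zeta7 ^+ i).
    by rewrite s0 mulr0 subr0.
  rewrite mulr_sumr -sumrB.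
  by apply: eq_bigr => i _; rewrite /b intrB mulrBl.
rewrite (bigD1 j) //= big1 => [|i /negPf ij]; rewrite bE ?ij ?eqxx.
  by rewrite addr0 mulr1 rmorphXn rmorphN.
by rewrite mulr0 mul0r.
Qed.

(** * Distinct factors over a field, and prime powers dividing a product *)

(** With [u = y ^+ k] and [y ^+ l = u ^+ j], the equality becomes
    [(u - u ^+ j) * (1 + u + u ^+ j) = 0]. If the second factor vanishes, [j = 2, 4, 6] give a
    primitive seventh root [v] with [1 + v + v ^+ 2 = 0], hence [v ^+ 3 = 1]; [j = 3, 5] combine
    with [Phi_7(u) = 0] into [2 = 0]. Characteristic 2 is a true exception: there [1 + u + u ^+ 3]
    divides [Phi_7]. *)
Lemma prim7_sums_inj (F : fieldType) (y : F) (k l : nat) :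
  7.-primitive_root y -> 2 != 0 :> F -> (0 < k < 7)%N -> (0 < l < 7)%N ->
  y ^+ k + y ^+ (2 * k) = y ^+ l + y ^+ (2 * l) -> k = l.
Proof.
move=> py two0 hk hl e; apply/eqP/negPn/negP => kl.
pose u := y ^+ k.
have pu : 7.-primitive_root u.
  rewrite prim_root_exp_coprime //.
  by move: k hk {e kl u} => [|[|[|[|[|[|[|]]]]]]].
have [j j7 yl] : exists2 j, (j < 7)%N & y ^+ l = u ^+ j.
  have [|i ->] := prim_rootP pu (x := y ^+ l); last by exists i.
  by rewrite exprAC (prim_expr_order py) expr1n.
have s0 := prim7_sum pu; have u7 := prim_expr_order pu.
have yl1 : u ^+ j != 1.
  rewrite -yl -(prim_order_dvd py); case/andP: hl => l0 l7.
  by rewrite gtnNdvd.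
have ylu : u ^+ j != u.
  by rewrite -yl /u (eq_prim_root_expr py) !modn_small 1?eq_sym //; case/andP: hk; case/andP: hl.
have {}e : 1 + u + u ^+ j = 0.
  have : (u - u ^+ j) * (1 + u + u ^+ j) = 0.
    transitivity (u + u ^+ 2 - (u ^+ j + u ^+ j ^+ 2)); first by ring.
    by rewrite -yl /u -!exprM -![(_ * 2)%N]mulnC e subrr.
  by move/eqP; rewrite mulf_eq0 subr_eq0 eq_sym (negPf ylu) => /eqP.
move: s0; rewrite !big_ord_recr big_ord0 /= add0r expr0 expr1 => s0.
have no3 (v : F) : 7.-primitive_root v -> 1 + v + v ^+ 2 <> 0.
  move=> pv ev; have : v ^+ 3 - 1 = (v - 1) * (1 + v + v ^+ 2) by ring.
  by rewrite ev mulr0 => /eqP; rewrite subr_eq0 -(prim_order_dvd pv).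
have no2 (E a c : F) : E = 0 -> 2 = a * E
    - (1 + u + u ^+ 2 + u ^+ 3 + u ^+ 4 + u ^+ 5 + u ^+ 6) + c * (u ^+ 7 - 1) -> False.
  by move=> ->; rewrite s0 u7 subrr !mulr0 subrr addr0 => /eqP; rewrite (negPf two0).
move: j7 yl1 ylu e {yl}; move: j => [|[|[|[|[|[|[|//]]]]]]] _;
  rewrite ?expr0 ?expr1 ?eqxx // => _ _ e.
- exact: (no3 u).
- by apply: (no2 _ (1 + u ^+ 4 + u ^+ 6) (- (2 + u ^+ 2)) e); ring.
- apply: (no3 (u ^+ 4)); first by rewrite prim_root_exp_coprime.
  transitivity (1 + u + u ^+ 4 + u * (u ^+ 7 - 1)); first by ring.
  by rewrite e u7 subrr mulr0 addr0.
- by apply: (no2 _ (1 + u ^+ 2 + u ^+ 6) (- (2 + u ^+ 4)) e); ring.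
- apply: (no3 u) => //.
  transitivity (u * (1 + u + u ^+ 6) - (u ^+ 7 - 1)); first by ring.
  by rewrite e u7 subrr mulr0 subr0.
Qed.

Lemma prime_coprimez (q : nat) (x : int) : prime q -> coprimez q x = ~~ (q %| x)%Z.
Proof. by move=> pq; rewrite coprimezE prime_coprime // dvdzE. Qed.

(** Once [q] divides one factor, the product of the others is coprime to [q ^ e], so the whole power
    divides that factor. *)
Lemma prime_power_dvdz_prod (q e : nat) (I : eqType) (r : seq I) (F : I -> int) :
  prime q -> (0 < e)%N -> uniq r ->
  {in r &, forall i j, (q %| F i)%Z -> (q %| F j)%Z -> i = j} ->
  ((q ^ e)%N %| \prod_(i <- r) F i)%Z -> exists2 i, i \in r & ((q ^ e)%N %| F i)%Z.
Proof.
move=> pq e0 ur inj d.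
have cop (P : pred I) : {in r, forall i, P i -> ~~ (q %| F i)%Z} ->
    coprimez (q ^ e)%N (\prod_(i <- r | P i) F i).
  move=> h; have -> : (q ^ e)%N%:Z = q%:Z ^+ e by rewrite -!natz natrX.
  rewrite coprimezXl // big_seq_cond.
  apply: (big_ind (fun x => coprimez q x)) => [|x y cx cy|i /andP[ir Pi]].
  - by rewrite /coprimez gcdz1.
  - by rewrite coprimezMr cx.
  - by rewrite prime_coprimez // h.
have [/hasP[i ir qi]|/hasPn h] := boolP (has (fun i => (q %| F i)%Z) r).
  exists i => //; move: d; rewrite (bigD1_seq i) //= mulrC Gauss_dvdzr //.
  by apply: cop => j jr; apply: contra => /(inj _ _ ir jr qi) ->.
have := cop predT (fun i ir _ => h i ir); rewrite coprimezE => c.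
move: d; rewrite dvdzE /= => d; move: c; rewrite /coprime (gcdn_idPl d).
by rewrite gtn_eqF // -{1}(expn0 q) ltn_exp2l // prime_gt1.
Qed.

(** * The linear systems comparing two elements of equal norm *)

(** A computable form of [zcoef]: with coefficients and exponents in separate lists, the residues
    can be evaluated while the coefficients stay symbolic, leaving plain linear expressions. *)
Fixpoint coefsum (cs : seq int) (es : seq nat) (r : nat) : int :=
  match cs, es with
  | c :: cs', i :: es' => if eqn i r then c + coefsum cs' es' r else coefsum cs' es' r
  | _, _ => 0
  end.

Lemma coefsum_eq (cs : seq int) (es : seq nat) :
  \sum_(t <- zip cs es) t.1%:~R * zeta7 ^+ t.2 = 0 ->
  forall r, (r < 7)%N ->
  coefsum cs [seq (i %% 7)%N | i <- es] r = coefsum cs [seq (i %% 7)%N | i <- es] 6.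
Proof.
have cE r : coefsum cs [seq (i %% 7)%N | i <- es] r = zcoef (zip cs es) r.
  elim: cs es => [|c cs IH] [|i es] /=; rewrite /zcoef ?big_nil // big_cons IH //.
by move=> /zcoef_eq h r r7; rewrite !cE h.
Qed.

(** Here [X, Y, Z, W] are [m m', m n', n m', n n'], and the equation says that [beta * conj alpha],
    times a root of unity up to sign, is [alpha * conj beta]. The nonvanishing sums are products
    such as [m (m' + n')] and [(m + n) (m' + n')]. *)
Lemma conj_linear (X Y Z W : int) (s : bool) (j k : nat) :
  (j < 7)%N -> (0 < k < 7)%N -> X * W = Y * Z ->
  [/\ X != 0, Y != 0, Z != 0 & W != 0] ->
  [/\ X + Y != 0, X + Z != 0, Z + W != 0, Y + W != 0 & X + Y + Z + W != 0] ->
  (-1) ^+ s * zeta7 ^+ j * (X%:~R - Y%:~R * (zeta7 ^+ (6 * k) + zeta7 ^+ (12 * k))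
      - Z%:~R * (zeta7 + zeta7 ^+ 2)
      + W%:~R * (zeta7 + zeta7 ^+ 2) * (zeta7 ^+ (6 * k) + zeta7 ^+ (12 * k)))
  = X%:~R - Y%:~R * (zeta7 ^+ k + zeta7 ^+ (2 * k))
      - Z%:~R * (zeta7 ^+ 6 + zeta7 ^+ 12)
      + W%:~R * (zeta7 ^+ 6 + zeta7 ^+ 12) * (zeta7 ^+ k + zeta7 ^+ (2 * k)) ->
  [\/ Y = Z, X + Y + W = 0 | X + Z + W = 0].
Proof.
move=> j7 k7 XW [X0 Y0 Z0 W0] [XY XZ ZW YW XYZW] e.
pose c x : int := if s then - x else x.
have /coefsum_eq h : \sum_(t <- zip
    [:: c X; - c Y; - c Y; - c Z; - c Z; c W; c W; c W; c W;
        - X; Y; Y; Z; Z; - W; - W; - W; - W]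
    [:: j; j + 6 * k; j + 12 * k; j + 1; j + 2; j + 1 + 6 * k; j + 2 + 6 * k;
        j + 1 + 12 * k; j + 2 + 12 * k;
        0; k; 2 * k; 6; 12; 6 + k; 12 + k; 6 + 2 * k; 12 + 2 * k]%N)
    t.1%:~R * zeta7 ^+ t.2 = 0.
  rewrite /= !big_cons big_nil /=.
  move/eqP: e; rewrite -subr_eq0 => /eqP e; rewrite -[RHS]e {e}.
  move: (6 * k)%N (12 * k)%N (2 * k)%N => k6 k12 k2.
  by rewrite /c; clear c; case: s => /=; rewrite !(rmorphN, exprD, expr0, expr1) /=; ring.
(* Two families of linear solutions are excluded only by [X * W = Y * Z]: this one would give
   [X ^+ 2 + X * Z + Z ^+ 2 = 0], the next [2 * X ^+ 2 = 0]. *)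
have caseB : W = X -> Y = - Z - X -> False.
  move=> eW eY; move: XW; rewrite eW eY => q.
  have : (2 * X + Z) ^+ 2 + 3 * Z ^+ 2 = 4 * (X * X - (- Z - X) * Z) by ring.
  rewrite q subrr; have := sqr_ge0 (2 * X + Z).
  by have : 0 < Z ^+ 2; [rewrite exprn_even_gt0|lia].
have caseC : Y = X -> Z = X -> W = - X -> False.
  move=> eY eZ eW; move: XW; rewrite eW eY eZ.
  by have : 0 < X ^+ 2; [rewrite exprn_even_gt0|rewrite expr2; lia].
rewrite /c in h; clear e XW c.
(* Each of the 84 cases is a linear system; apart from the two excluded above it
   forces one of the conclusions or the vanishing of a nonzero quantity. *)
move: j j7 k k7 h => [|[|[|[|[|[|[|//]]]]]]] _ [|[|[|[|[|[|[|//]]]]]]] // _; case: s => h;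
  move: (h 0%N isT) (h 1%N isT) (h 2%N isT) (h 3%N isT) (h 4%N isT) (h 5%N isT); clear h;
  match goal with |- context [map ?f ?es] =>
    let v := eval vm_compute in (map f es) in change (map f es) with v end;
  cbn [coefsum eqn] => t0 t1 t2 t3 t4 t5;
  (first [ by exfalso; clear caseB caseC; lia
    | by clear caseB caseC; apply: Or31; lia | by clear caseB caseC; apply: Or32; lia
    | by clear caseB caseC; apply: Or33; lia
    | by exfalso; apply: caseB; lia | by exfalso; apply: caseC; lia ]).
Qed.

(** * The ramified prime 7, and the factor divisible by [N] *)

Lemma prime_dvdzX (q : nat) (x : int) (k : nat) : prime q -> (q %| x ^+ k)%Z -> (q %| x)%Z.
Proof.
move=> pq; apply: contraTT; rewrite -prime_coprimez // => c.
by rewrite -prime_coprimez // coprimezXr.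
Qed.

(** As 7 is totally ramified, [zeta] is 1 modulo the prime above it, and the norm becomes
    [(m - 2 * n) ^+ 6] modulo 7. *)
Lemma dvd7_polyA (m n : int) : (7 %| polyAmn m n)%Z -> (7 %| m - 2 * n)%Z.
Proof.
move=> d; apply: (@prime_dvdzX 7 _ 6) => //.
have -> : (m - 2 * n) ^+ 6 = polyAmn m n - (2 * m ^+ 5 * n - 8 * m ^+ 4 * n ^+ 2
    + 24 * m ^+ 3 * n ^+ 3 - 33 * m ^+ 2 * n ^+ 4 + 28 * m * n ^+ 5 - 9 * n ^+ 6) * 7.
  by rewrite /polyAmn; ring.
by apply: rpredB => //; apply: dvdz_mull.
Qed.

Lemma ndvd49_polyA (m n : int) : coprimez m n -> ~~ (49 %| polyAmn m n)%Z.
Proof.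
move=> cmn; apply/negP => d49.
have d7 : (7 %| polyAmn m n)%Z by apply: dvdz_trans d49.
have /dvdzP[k kE] := dvd7_polyA d7.
have d : (7 %| n)%Z.
  apply: (@prime_dvdzX 7 _ 6) => //.
  (* With [m = 7 * k + 2 * n], the form is [A(2, 1) * n ^+ 6] modulo 49, and
     [A(2, 1) = 301 = 7 * 43]. *)
  rewrite -(@Gauss_dvdzr _ 43) // -(@dvdz_mul2l 7 _ _) //.
  have -> : 7 * (43 * n ^+ 6) = polyAmn m n - 49 * (49 * 49 * k ^+ 6
    + k * (2 * m ^+ 4 * n - 4 * m ^+ 3 * n ^+ 2
     + 16 * m ^+ 2 * n ^+ 3 - m * n ^+ 4 + 26 * n ^+ 5)).
    have -> : m = k * 7 + 2 * n by rewrite -kE subrK.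
    by rewrite /polyAmn; ring.
  by apply: rpredB => //; apply: dvdz_mulr.
have dm : (7 %| m)%Z.
  by have -> : m = k * 7 + 2 * n; [rewrite -kE subrK | apply: rpredD; apply: dvdz_mull].
have : (7 %| gcdz m n)%Z by rewrite dvdz_gcd dm d.
by rewrite (eqP cmn).
Qed.

Lemma sum7_prim (F : fieldType) (y : F) :
  \sum_(i < 7) y ^+ i = 0 -> 7 != 0 :> F -> 7.-primitive_root y.
Proof.
move=> s0 n7; have y7 : y ^+ 7 = 1 by apply/eqP; rewrite -subr_eq0 subrX1 s0 mulr0.
have [[|[|k]] // p d] := prim_order_exists (isT : (0 < 7)%N) y7.
  move: (prim_expr_order p) n7; rewrite expr1 => y1; rewrite y1 in s0.
  by move: s0; under eq_bigr => i _ do rewrite expr1n; rewrite sumr_const card_ord => ->;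
    rewrite eqxx.
by have /primeP[_ /(_ _ d)] : prime 7 by []; rewrite /= => /eqP <-.
Qed.

(** In ['F_q] the integer [w] becomes a primitive seventh root of unity, and [n] is invertible,
    since otherwise [q] would divide both [m] and [n]; [prim7_sums_inj] then applies. *)
Lemma prime_factor_unique (q : nat) (w m n : int) : prime q -> q != 2%N -> q != 7%N ->
  coprimez m n -> (q %| \sum_(i < 7) w ^+ i)%Z ->
  {in index_iota 1 7 &, forall k l, (q %| m - (w ^+ k + w ^+ (2 * k)) * n)%Z ->
    (q %| m - (w ^+ l + w ^+ (2 * l)) * n)%Z -> k = l}.
Proof.
move=> pq q2 q7 cmn dw k l; rewrite !mem_index_iota => hk hl.
have ch := pchar_Fp pq.
have nz p : prime p -> q != p -> p%:R != 0 :> 'F_q.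
  by move=> pp ne; rewrite -(dvdn_pcharf ch) dvdn_prime2.
have y0 : \sum_(i < 7) (w%:~R : 'F_q) ^+ i = 0.
  move: dw; rewrite (dvdz_pcharf ch) rmorph_sum => /eqP h; rewrite -[RHS]h.
  by apply: eq_bigr => i _; rewrite rmorphXn.
have py := sum7_prim y0 (nz 7%N isT q7).
rewrite !(dvdz_pcharf ch) !rmorphB !rmorphM !rmorphD !rmorphXn /= !subr_eq0 => /eqP ek /eqP el.
have n0 : n%:~R != 0 :> 'F_q.
  apply/eqP => n0; have m0 : m%:~R = 0 :> 'F_q by rewrite ek n0 mulr0.
  have : (q %| gcdz m n)%Z by rewrite dvdz_gcd !(dvdz_pcharf ch) m0 n0 eqxx.
  by rewrite (eqP cmn) dvdz1 /= => /eqP q1; move: pq; rewrite q1.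
apply: (prim7_sums_inj py (nz 2%N isT q2) hk hl).
by apply: (mulIf n0); rewrite -ek -el.
Qed.

(** The power of [q] falls into a single factor. A further 7 divides every factor, because [w] is 1
    and [m] is [2 * n] modulo 7; in that case [q] differs from 7 since 49 does not divide the
    form. *)
Lemma polyA_factor (q e : nat) (N w m n : int) : prime q -> (0 < e)%N ->
  coprimez m n -> polyAmn m n = N -> (N %| \sum_(i < 7) w ^+ i)%Z ->
  (N = (q ^ e)%N /\ q != 7%N) \/ N = 7 * (q ^ e)%N%:Z ->
  exists2 k, (0 < k < 7)%N & (N %| m - (w ^+ k + w ^+ (2 * k)) * n)%Z.
Proof.
move=> pq e0 cmn AN dw hN.
have q7 : q != 7%N.
  case: hN => [[]//|NE]; apply/negP => /eqP q7.
  have := ndvd49_polyA cmn; rewrite AN NE q7 -(prednK e0) expnS PoszM mulrA.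
  by rewrite dvdz_mulr.
have dqeN : ((q ^ e)%N%:Z %| N)%Z by case: hN => [[->]|->] //; apply: dvdz_mull.
have dqqe : (q%:Z %| (q ^ e)%N%:Z)%Z by rewrite dvdzE /= dvdn_exp.
have dqN : (q%:Z %| N)%Z := dvdz_trans dqqe dqeN.
have q2 : q != 2%N.
  apply/negP => /eqP q2; have := odd_polyA cmn; rewrite coprimez_sym.
  by rewrite -[2]/(2%N%:Z) prime_coprimez // AN -q2 dqN.
pose F k := m - (w ^+ k + w ^+ (2 * k)) * n.
have dF : (N %| \prod_(1 <= k < 7) F k)%Z.
  have := norm_modz m n dw; rewrite -/(F _) AN => h.
  by have := rpredD h (dvdzz N); rewrite subrK.
have [k] := prime_power_dvdz_prod pq e0 (iota_uniq _ _)
   (prime_factor_unique pq q2 q7 cmn (dvdz_trans dqN dw)) (dvdz_trans dqeN dF).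
rewrite mem_iota => hk dk; exists k => //.
case: hN => [[-> //]|NE]; rewrite NE Gauss_dvdz; last first.
  by rewrite coprimezE /= coprimeXr // prime_coprime // dvdn_prime2 // eq_sym.
rewrite dk andbT.
have d7N : (7 %| N)%Z by rewrite NE dvdz_mulr.
have dw1 : (7 %| w - 1)%Z.
  apply: (@prime_dvdzX 7 _ 6) => //.
  have -> : (w - 1) ^+ 6 = \sum_(i < 7) w ^+ i
     - (w - 2 * w ^+ 2 + 3 * w ^+ 3 - 2 * w ^+ 4 + w ^+ 5) * 7.
    by rewrite !big_ord_recr big_ord0 /=; ring.
  by apply: rpredB; [apply: dvdz_trans dw|apply: dvdz_mull].
have dX j : (7 %| w ^+ j - 1)%Z by rewrite subrX1 dvdz_mulr.
have -> : m - (w ^+ k + w ^+ (2 * k)) * n =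
    m - 2 * n - (w ^+ k - 1 + (w ^+ (2 * k) - 1)) * n by ring.
apply: rpredB; first by apply: dvd7_polyA; rewrite AN.
by apply: dvdz_mulr; apply: rpredD.
Qed.

(** * Associate elements and the three parameters of a cycle *)

Lemma evz_prod (I : Type) (r : seq I) (F : I -> {poly int}) y :
  evz (\prod_(i <- r) F i) y = \prod_(i <- r) evz (F i) y.
Proof. by rewrite /evz rmorph_prod horner_prod. Qed.

Lemma evz_sub_horner (p : {poly int}) (w : int) : exists s : {poly int},
  forall y, evz p y = evz s y * (y - w%:~R) + (p.[w])%:~R.
Proof.
have /factor_theorem[s sE] : root (p - (p.[w])%:P) w.
  by rewrite /root hornerD hornerN hornerC subrr.
exists s => y; rewrite -[p in LHS](subrK (p.[w])%:P) sE evzD evzM evzC.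
by rewrite evzD evzN evzX evzC.
Qed.

Lemma norm_thpoly (m n : int) y : 7.-primitive_root y ->
  evz (\prod_(1 <= k < 7) thpoly m n k) y = (polyAmn m n)%:~R.
Proof.
move=> py; rewrite -(norm_prim7 _ _ py) evz_prod.
by apply: eq_bigr => k _; rewrite evz_thpoly.
Qed.

Lemma thpoly_comp m n (k j : nat) y : evz (thpoly m n k) (y ^+ j) = evz (thpoly m n j) (y ^+ k).
Proof.
rewrite !evz_thpoly -!exprM; congr (_ - (_ + _) * _); congr (_ ^+ _); lia.
Qed.

Lemma associate_ratio (m n m' n' N w : int) (d : {poly int}) (k : nat) :
  m * n * (m + n) != 0 -> m' * n' * (m' + n') != 0 -> N != 0 ->
  polyAmn m n = N -> polyAmn m' n' = N ->
  zeta7 - w%:~R = evz (thpoly m n 1) zeta7 * evz d zeta7 ->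
  (0 < k < 7)%N -> (N %| m' - (w ^+ k + w ^+ (2 * k)) * n')%Z ->
  [\/ m * n' = n * m', m * m' + m * n' + n * n' = 0 | m * m' + n * m' + n * n' = 0].
Proof.
move=> h h' N0 AN AN' dE hk /dvdzP[t tE].
have pz := zeta7_prim; have z7 := prim_expr_order pz.
pose be := thpoly m n 1; pose al := thpoly m' n' k.
pose bs := \prod_(2 <= j < 7) thpoly m n j.
have bsE y : 7.-primitive_root y -> evz be y * evz bs y = N%:~R.
  by move=> py; rewrite -AN -(norm_thpoly m n py) big_ltn // evzM.
have [s sE] := evz_sub_horner al w.
(* The quotient [alpha / beta]: [alpha = s * (zeta7 - w) + t * N], where [zeta7 - w = beta * d] and
   [N = beta * bs]. *)
pose p := s * d + t%:P * bs.
have pE y : 7.-primitive_root y -> evz p y * evz be y = evz al y.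
  move=> py; apply/eqP; rewrite -subr_eq0 -evzM -evzN -evzD.
  apply/eqP; apply: evz_conj => //.
  rewrite evzD evzN !evzM (sE zeta7) dE /p evzD !evzM evzC horner_thpoly tE.
  by rewrite intrM -(bsE _ pz) -/be; ring.
have pNorm : \prod_(1 <= j < 7) evz p (zeta7 ^+ j) = 1.
  have N0' : N%:~R != 0 :> algC by rewrite intr_eq0.
  apply: (mulIf N0'); rewrite mul1r -{1}AN -(norm_thpoly m n pz) evz_prod -big_split /=.
  rewrite -{1}AN' -(norm_thpoly m' n' (zeta7_pow_prim hk)) evz_prod.
  rewrite !big_nat; apply: eq_bigr => j hj.
  have := pE _ (zeta7_pow_prim hj); rewrite /be /al thpoly_comp expr1 => ->.
  by rewrite thpoly_comp.
(* As [p] has norm 1, the product of its other conjugates is its inverse. *)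
pose u := \prod_(2 <= j < 7) (p \Po 'X^j).
have uE y : 7.-primitive_root y -> evz p y * evz u y = 1.
  move=> py; apply/eqP; rewrite -subr_eq0 [X in _ - X](_ : 1 = evz 1%:P y) -?evzM; last
    by rewrite evzC.
  rewrite -evzN -evzD.
  apply/eqP; apply: evz_conj => //.
  rewrite evzD evzN evzC evzM -pNorm big_ltn // expr1 /u evz_prod.
  under eq_bigr => j _ do rewrite evz_comp evzXn evzX.
  by rewrite subrr.
(* This is [p / conj p], since ['X^6] acts as complex conjugation on powers of [zeta7]. *)
pose g := p * (u \Po 'X^6).
have z36 : (zeta7 ^+ 6) ^+ 6 = zeta7 by rewrite -exprM -(expr_mod _ z7) expr1.
have p6 := @zeta7_pow_prim 6 isT.
have gg : evz g zeta7 * evz g (zeta7 ^+ 6) = 1.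
  rewrite /g !evzM !evz_comp !evzXn !evzX z36.
  have := uE _ pz; have := uE _ p6.
  set a1 := evz p _; set a2 := evz u _; set a3 := evz p _; set a4 := evz u _ => e1 e2.
  by transitivity ((a1 * a2) * (a3 * a4)); [ring|rewrite e1 e2 mulr1].
have [sg [j [j7 gE]]] := unit_circle_zeta7 gg.
have key : evz g zeta7 * evz be zeta7 * evz al (zeta7 ^+ 6) =
    evz al zeta7 * evz be (zeta7 ^+ 6).
  rewrite -(pE _ pz) -(pE _ p6) /g evzM evz_comp evzXn evzX.
  transitivity (evz p zeta7 * evz be zeta7 * evz be (zeta7 ^+ 6)
     * (evz p (zeta7 ^+ 6) * evz u (zeta7 ^+ 6))); first by ring.
  by rewrite uE // mulr1.
move: h h'; rewrite !mulf_eq0 !negb_or => /andP[/andP[m0 n0] mn0] /andP[/andP[m0' n0'] mn0'].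
apply: (@conj_linear (m * m') (m * n') (n * m') (n * n') sg j k) => //.
- by ring.
- by split; rewrite mulf_neq0.
- by split; [rewrite -mulrDr|rewrite -mulrDl|rewrite -mulrDr|rewrite -mulrDl
    |rewrite -mulrDr -addrA -mulrDr -mulrDl]; rewrite mulf_neq0.
move: key; rewrite gE /be /al !evz_thpoly muln1 expr1 !intrM; move: zeta7 => z.
rewrite -!exprM (mulnA 6 2 k).
move: (6 * k)%N (6 * 2 * k)%N (2 * k)%N => k6 k12 k2 key.
by apply: etrans (etrans _ key) _; ring.
Qed.

(** With [t = m / n], the relations say that [m' / n'] is [t], [- (t + 1) / t] or [- 1 / (t + 1)]:
    the orbit of [t] under a map of order 3 that leaves [cdyn] invariant. *)
Lemma cpar_eq_ratio (m n m' n' : int) :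
  m * n * (m + n) != 0 -> m' * n' * (m' + n') != 0 ->
  [\/ m * n' = n * m', m * m' + m * n' + n * n' = 0 | m * m' + n * m' + n * n' = 0] ->
  cpar m' n' = cpar m n.
Proof.
move=> h h'; rewrite !cpar_cdyn //; move: h h'.
rewrite !mulf_eq0 !negb_or => /andP[/andP[m0 n0] mn0] /andP[/andP[m0' n0'] mn0'].
have m0r : m%:~R != 0 :> rat by rewrite intr_eq0.
have n0r : n%:~R != 0 :> rat by rewrite intr_eq0.
have m0r' : m'%:~R != 0 :> rat by rewrite intr_eq0.
have n0r' : n'%:~R != 0 :> rat by rewrite intr_eq0.
have mn0r : m%:~R + n%:~R != 0 :> rat by rewrite -intrD intr_eq0.
case=> /(congr1 (fun x : int => x%:~R : rat)); rewrite !(intrM, intrD) => e.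
- have -> : m'%:~R / n'%:~R = m%:~R / n%:~R :> rat.
    by apply/eqP; rewrite eqr_div //; apply/eqP; lra.
  by [].
- have -> : m'%:~R / n'%:~R = - (m%:~R + n%:~R) / m%:~R :> rat.
    by apply/eqP; rewrite eqr_div //; apply/eqP; lra.
  by rewrite /cdyn; field; rewrite m0r n0r mn0r; lra.
- have -> : m'%:~R / n'%:~R = - n%:~R / (m%:~R + n%:~R) :> rat.
    by apply/eqP; rewrite eqr_div //; apply/eqP; lra.
  by rewrite /cdyn; field; rewrite m0r n0r mn0r; lra.
Qed.

(** * Denominators that are powers of 2, and the five claims *)

Lemma odd_dvd_pow2 (a : int) (k : nat) : (2 * a + 1 %| 2 ^+ k)%Z ->
  2 * a + 1 = 1 \/ 2 * a + 1 = -1.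
Proof.
move=> d; have c : coprimez (2 * a + 1) (2 ^+ k).
  by rewrite coprimezXr // coprimez_sym mulrC /coprimez gcdzMDl.
have : (2 * a + 1 %| 1)%Z by rewrite -[X in (_ %| X)%Z](eqP c) dvdz_gcd dvdzz.
by rewrite dvdz1 => /eqP; lia.
Qed.

(** Each of [m], [n], [m + n] divides a power of 2, and exactly two of them are odd, hence equal to
    1 or -1. This forces [m = n], [n = - 2 m] or [m = - 2 n]. *)
Lemma cycle_pow2_denom (c : rat) (k : nat) :
  has_rat_3cycle c -> denq c = 2 ^+ k -> c = - 29 / 16.
Proof.
move=> /cycle_cpar[m [n [cmn h ->]]]; have [_ ->] := cpar_num_den cmn h => e.
have dm : (m %| 2 ^+ k)%Z by rewrite -e polyB_sqr; apply/dvdzP;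
  exists (4 * m * n ^+ 2 * (m + n) ^+ 2); ring.
have dn : (n %| 2 ^+ k)%Z by rewrite -e polyB_sqr; apply/dvdzP;
  exists (4 * m ^+ 2 * n * (m + n) ^+ 2); ring.
have ds : (m + n %| 2 ^+ k)%Z by rewrite -e polyB_sqr; apply/dvdzP;
  exists (4 * m ^+ 2 * n ^+ 2 * (m + n)); ring.
have h' := h; move: h'; rewrite !mulf_eq0 !negb_or -andbA => /and3P[m0 n0 s0].
apply: cpar_special => //; apply/eqP; rewrite !mulf_eq0.
have [a am] := int_parity m; have [b bn] := int_parity n.
have par x y : (x %| 2 ^+ k)%Z -> x = 2 * y + 1 -> x = 1 \/ x = -1.
  by move=> dx xE; rewrite xE in dx *; apply: odd_dvd_pow2 dx.
case: am => am; case: bn => bn.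
- have : (2 %| gcdz m n)%Z by rewrite dvdz_gcd am bn !dvdz_mulr.
  by rewrite (eqP cmn).
- have {par} [nE sE] := (par _ b dn bn, par _ (a + b) ds); clear -am bn nE sE m0 n0 s0; lia.
- have {par} [mE sE] := (par _ a dm am, par _ (a + b) ds); clear -am bn mE sE m0 n0 s0; lia.
- have {par} [mE nE] := (par _ a dm am, par _ b dn bn); clear -am bn mE nE m0 n0 s0; lia.
Qed.

Theorem theorem2 (m n : int) :
  coprimez m n -> m * n * (m + n) != 0 ->
  (* (a) *)
  [/\ coprimez (polyAmn m n) (polyBmn m n),
      numq (cpar m n) = - polyAmn m n,
      denq (cpar m n) = polyBmn m n,
      (2 %| (m * n * (m + n))%R)%Z &
      polyBmn m n = 16 * polyCmn m n ^+ 2 ] /\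
  (* (b) *)
  ratr (cpar m n) = - (norm_Qzeta7 m n / ((4 * polyCmn m n) ^+ 2)%:~R) /\
  (* (c) *)
  (has_rat_3cycle (- 29 / 16) /\
   forall c : rat, has_rat_3cycle c -> (exists k : nat, denq c = 2 ^+ k) ->
     c = - 29 / 16) /\
  (* (d) *)
  ((forall c : rat, has_rat_3cycle c -> denq c = denq (cpar m n) -> c = cpar m n) ->
     cpar m n = - 29 / 16) /\
  (* (e) *)
  (forall (q e : nat), prime q -> (0 < e)%N ->
     ((polyAmn m n = (q ^ e)%N%:Z /\ q != 7%N) \/ polyAmn m n = 7 * (q ^ e)%N%:Z) ->
     forall c : rat, has_rat_3cycle c -> numq c = - polyAmn m n -> c = cpar m n).
Proof.
move=> cmn h; have [num den] := cpar_num_den cmn h.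
split; first by split=> //; [exact: coprime_polyA_polyB | exact: even_prod_sum | exact: polyC_sqr].
split.
  rewrite /norm_Qzeta7 (norm_prim7 _ _ zeta7_prim) /cpar rmorphN fmorph_div /= !ratr_int.
  by rewrite polyC_sqr exprMn.
split.
  split=> [|c cc [k]]; last exact: cycle_pow2_denom.
  by rewrite -cpar11; apply: cpar_cycle.
split=> [uniq|q e pq e0 hA c /cycle_cpar[m' [n' [cmn' h' ->]]]].
  (* Uniqueness is applied to the cycle of the exchanged pair [(n, m)], which has the same
     denominator. *)
  have h' : n * m * (n + m) != 0 by rewrite [n * m]mulrC [n + m]addrC.
  have [num' den'] := cpar_num_den (etrans (coprimez_sym _ _) cmn) h'.
  have eB : polyBmn n m = polyBmn m n by rewrite /polyBmn; ring.
  have := uniq _ (cpar_cycle h'); rewrite den den' eB => /(_ erefl) /(congr1 numq).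
  rewrite num num' => /oppr_inj eA; apply: cpar_special => //.
  have := polyA_swap m n; rewrite eA subrr => /esym/eqP.
  by rewrite mulf_eq0 oppr_eq0 (negPf h) => /eqP.
have [-> _] := cpar_num_den cmn' h' => /oppr_inj eA.
have A0 : polyAmn m n != 0.
  have q0 : (q ^ e)%N != 0%N by rewrite -lt0n expn_gt0 prime_gt0.
  by case: hA => [[->]|->] //; rewrite mulf_neq0.
have [w [d [dE dw]]] := zeta7_modz cmn h.
have [k hk dk] := polyA_factor pq e0 cmn' eA dw hA.
exact: cpar_eq_ratio (associate_ratio h h' A0 erefl eA dE hk dk).
Qed.
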